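(* Let $n$ be an even positive integer, let $a>1$, $p>0$, and let $\rho:\mathbb{R}^+\to\mathbb{C}$ be a nowhere vanishing function such that $\rho(ax)=\rho(x)$ for every $x$. Let $(\psi_j)_{j\in\mathbb{Z}}$ be the discrete wavelets in $\mathbb{C}^n$ given by $$\hat\psi_j[k]=\rho(a^jk)(a^jk)^pe^{-a^jk}1_{k\geq 0},\qquad j\in\mathbb{Z},\ k=-\tfrac n2+1,\dots,\tfrac n2 .$$ Let $f,g\in\mathbb{C}^n$ and let $j,l\in\mathbb{Z}$ be two distinct integers. Then $$|f\star\psi_j|=|g\star\psi_j|\quad\text{and}\quad|f\star\psi_l|=|g\star\psi_l|$$ if and only if, for some $\phi\in\mathbb{R}$ and $c\in\mathbb{C}$, $$f_+=e^{i\phi}g_++c .$$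
   Context: For $f\in\mathbb{C}^n$ the discrete Fourier transform is $\hat f[k]=\sum_{s=0}^{n-1}f[s]e^{-2\pi i sk/n}$ for $k=-\frac n2+1,\dots,\frac n2$. The symbol $\star$ denotes circular convolution, i.e. $f\star\psi_j\in\mathbb{C}^n$ is the signal with discrete Fourier transform $\hat f[k]\hat\psi_j[k]$; moduli are taken entrywise. For $k<0$ the expression $\hat\psi_j[k]$ is $0$ (and $\hat\psi_j[0]=0$). The analytic part $f_+\in\mathbb{C}^n$ of $f$ is defined by $\hat f_+[k]=0$ if $-\frac n2+1\leq k<0$; $\hat f_+[k]=\hat f[k]$ if $k=0$ or $k=\frac n2$; $\hat f_+[k]=2\hat f[k]$ if $0<k<\frac n2$. In $f_+=e^{i\phi}g_++c$, the scalar $c$ denotes the constant signal equal to $c$. *)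

(* Defs.v *)
From HB Require Import structures.
From mathcomp Require Import all_boot all_order all_algebra.
From mathcomp Require Import complex ring lra zify.
From mathcomp Require Import reals exp trigo.

Set Implicit Arguments.
Unset Strict Implicit.
Unset Printing Implicit Defensive.

Import Order.TTheory GRing.Theory Num.Theory.

Local Open Scope ring_scope.
Local Open Scope complex_scope.

(* [e^{i x}]; neither library provides the complex exponential. *)
Definition cis {R : realType} (x : R) : R[i] := cos x +i* sin x.

Definition freq (n : nat) (k : int) : bool :=
  - (n./2)%:Z + 1 <= k <= (n./2)%:Z.

(* Enumerates [freq n] when [n] is even. *)
Definition freq_of (n : nat) (m : 'I_n) : int := m%:Z - (n./2)%:Z + 1.

Definition dft {R : realType} {n : nat} (f : 'rV[R[i]]_n) (k : int) : R[i] :=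
  \sum_(s < n) f 0 s * cis (- (2 * pi * s%:R * k%:~R / n%:R)).

(* For even [n], the unique signal whose [dft] agrees with [h] on [freq n]:
   see [idftK] and [dftK]. *)
Definition idft {R : realType} {n : nat} (h : int -> R[i]) : 'rV[R[i]]_n :=
  \row_(s < n) (n%:R^-1 * \sum_(m < n)
    h (freq_of m) * cis (2 * pi * s%:R * (freq_of m)%:~R / n%:R)).

(* Its [dft] is the pointwise product of the [dft]s: see [dft_circ_conv]. *)
Definition circ_conv {R : realType} {n : nat} (f g : 'rV[R[i]]_n) :
    'rV[R[i]]_n :=
  \row_(s < n) \sum_(t < n) \sum_(u < n | (t + u == s %[mod n])%N)
    f 0 t * g 0 u.

Definition modulus {R : realType} {n : nat} (f : 'rV[R[i]]_n) :
    'rV[R[i]]_n :=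
  map_mx Num.norm f.

Definition analytic_part {R : realType} {n : nat} (f : 'rV[R[i]]_n) :
    'rV[R[i]]_n :=
  idft (fun k : int => if k < 0 then 0
                       else if (k == 0) || (k == (n./2)%:Z) then dft f k
                       else 2 * dft f k).

Lemma cis0 (R : realType) : cis (0 : R) = 1.
Proof. by rewrite /cis cos0 sin0. Qed.

Lemma cisD (R : realType) (x y : R) : cis (x + y) = cis x * cis y.
Proof.
rewrite /cis cosD sinD; apply/eqP; rewrite eq_complex /=.
by rewrite eqxx andTb [sin x * _ + _]addrC.
Qed.

Lemma cisMn (R : realType) (x : R) (m : nat) : cis (m%:R * x) = cis x ^+ m.
Proof.
elim: m => [|m IH]; first by rewrite mul0r cis0.
by rewrite exprS -IH -cisD; congr cis; rewrite -natr1; ring.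
Qed.

Lemma cisNM (R : realType) (x : R) : cis (- x) * cis x = 1.
Proof. by rewrite -cisD addNr cis0. Qed.

Lemma cis_period (R : realType) (z : int) : cis (2 * pi * z%:~R : R) = 1.
Proof.
have pos (m : nat) : cis (2 * pi * m%:R : R) = 1.
  rewrite [_ * m%:R]mulrC cisMn /cis.
  by rewrite [2 * pi]mulr_natl cos2pi sin2pi expr1n.
case: z => m; first exact: pos.
have := cisNM (2 * pi * m.+1%:R : R); rewrite pos mulr1 => h.
by rewrite NegzE mulrNz mulrN.
Qed.

Lemma cis_neq1 (R : realType) (x : R) : 0 < x < pi -> cis (2 * x) != 1.
Proof.
move=> /sin_gt0_pi s0; apply/negP => /eqP [].
have := sin2cos2 x; rewrite mulr_natl mulr2n cosD => h c _.
have : 0 < sin x ^+ 2 by rewrite exprn_gt0.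
by move: h c; rewrite !expr2; lra.
Qed.

Lemma sum_cis (R : realType) (n : nat) (d : int) : (`|d| < n)%N ->
  \sum_(s < n) cis (2 * pi * s%:R * d%:~R / n%:R : R)
  = if d == 0 then n%:R else 0.
Proof.
move=> dn; have n0 : (n%:R : R) != 0 by rewrite pnatr_eq0; lia.
have n0' : (0 : R) < n%:R by rewrite ltr0n; lia.
case: eqP => [->|/eqP d0].
  rewrite (eq_bigr (fun=> 1)); first by rewrite sumr_const card_ord.
  by move=> s _; rewrite mulr0 mul0r cis0.
pose w := cis (2 * pi * d%:~R / n%:R : R).
rewrite (eq_bigr (fun s : 'I_n => w ^+ s)); last first.
  by move=> s _; rewrite /w -cisMn; congr cis; ring.
have wn : w ^+ n = 1.
  by rewrite /w -cisMn -(cis_period R d); congr cis; field.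
have w1 : w != 1.
  wlog dpos : d d0 dn @w wn / 0 < d => [H|].
    have [|] := ltP 0 d => d1; first exact: H.
    have /negP H' : cis (2 * pi * (- d)%:~R / n%:R : R) != 1.
      apply: H; [lia|lia| |lia].
      by rewrite -cisMn -(cis_period R (- d)); congr cis; field.
    apply/negP => /eqP w1; apply: H'; apply/eqP.
    by have := cisNM (2 * pi * d%:~R / n%:R : R); rewrite -/w w1 mulr1 => h;
       rewrite mulrNz mulrN mulNr.
  have -> : w = cis (2 * (pi * d%:~R / n%:R)).
    by rewrite /w; congr cis; ring.
  apply: cis_neq1; rewrite divr_gt0 ?mulr_gt0 ?pi_gt0 ?ltr0z //=.
  rewrite ltr_pdivrMr // ltr_pM2l ?pi_gt0 //.
  by rewrite -[n%:R]/((n%:Z)%:~R) ltr_int; lia.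
have := subrX1 w n; rewrite wn subrr => /esym/eqP.
by rewrite mulf_eq0 subr_eq0 (negPf w1) => /eqP.
Qed.

Lemma freqP (n : nat) (k : int) : ~~ odd n -> freq n k ->
  exists m : 'I_n, k = freq_of m.
Proof.
move=> en /andP[h1 h2].
have hm : (`|(k + (n./2)%:Z - 1)%R| < n)%N by lia.
by exists (Ordinal hm); rewrite /freq_of /=; lia.
Qed.

Lemma freq_ofP (n : nat) (m : 'I_n) : ~~ odd n -> freq n (freq_of m).
Proof. by move=> en; have := ltn_ord m; rewrite /freq /freq_of; lia. Qed.

Lemma idftK (R : realType) (n : nat) (h : int -> R[i]) (k : int) :
  ~~ odd n -> freq n k -> dft (idft h : 'rV_n) k = h k.
Proof.
move=> en /(freqP en)[m ->] {k}.
have n0 : (n%:R : R[i]) != 0 by rewrite pnatr_eq0; have := ltn_ord m; lia.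
rewrite /dft; under eq_bigr => s _ do rewrite mxE -[_ * _ * cis _]mulrA mulr_suml.
rewrite -mulr_sumr exchange_big /= (bigD1 m) //= [X in _ + X]big1 => [|q qm].
  rewrite addr0; under eq_bigr => s _ do rewrite -[_ * cis _ * cis _]mulrA -cisD subrr cis0 mulr1.
  by rewrite sumr_const card_ord -[h _ *+ n]mulr_natl mulKf.
have dn : (`|(freq_of q - freq_of m)%R| < n)%N.
  by have := ltn_ord m; have := ltn_ord q; rewrite /freq_of; lia.
have := sum_cis R dn; rewrite ifN => [H|]; last first.
  by rewrite /freq_of; move: qm; rewrite -val_eqE /=; lia.
rewrite -[RHS](mulr0 (h (freq_of q))) -[in RHS]H mulr_sumr; apply: eq_bigr => s _.
by rewrite -[_ * cis _ * cis _]mulrA -cisD; congr (_ * cis _); rewrite rmorphB /=; ring.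
Qed.

Lemma dftK (R : realType) (n : nat) (f : 'rV[R[i]]_n) : idft (dft f) = f.
Proof.
apply/rowP => s; rewrite mxE.
have n0 : (n%:R : R[i]) != 0 by rewrite pnatr_eq0; have := ltn_ord s; lia.
have n0' : (n%:R : R) != 0 by rewrite pnatr_eq0; have := ltn_ord s; lia.
under eq_bigr => m _ do rewrite mulr_suml.
rewrite exchange_big /= (bigD1 s) //= [X in _ + X]big1 => [|t ts].
  rewrite addr0; under eq_bigr => m _ do rewrite -[_ * cis _ * cis _]mulrA -cisD addNr cis0 mulr1.
  by rewrite sumr_const card_ord -[f _ _ *+ n]mulr_natl mulKf.
have dn : (`|(s%:Z - t%:Z)%R| < n)%N.
  by have := ltn_ord s; have := ltn_ord t; lia.
have := sum_cis R dn; rewrite ifN => [H|]; last first.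
  by move: ts; rewrite -val_eqE /=; lia.
pose c := cis (2 * pi * (s%:Z - t%:Z)%:~R * (1 - (n./2)%:R) / n%:R : R).
rewrite -[RHS](mulr0 (f 0 t * c)) -[in RHS]H mulr_sumr; apply: eq_bigr => m _.
rewrite -[LHS]mulrA -[RHS]mulrA /c -!cisD; congr (_ * cis _).
rewrite /freq_of !rmorphD /= !rmorphN /= -!pmulrn; ring.
Qed.

Lemma dft_circ_conv (R : realType) (n : nat) (f g : 'rV[R[i]]_n) (k : int) :
  dft (circ_conv f g) k = dft f k * dft g k.
Proof.
rewrite /dft mulr_suml.
under eq_bigr => s _ do rewrite mxE mulr_suml.
rewrite exchange_big /=; apply: eq_bigr => t _.
under eq_bigr => s _ do rewrite mulr_suml big_mkcond /=.
rewrite exchange_big /= mulr_sumr; apply: eq_bigr => u _.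
have n0 : (0 < n)%N by have := ltn_ord t; lia.
have n0' : (n%:R : R) != 0 by rewrite pnatr_eq0 -lt0n.
rewrite -big_mkcond /= (big_pred1 (Ordinal (ltn_pmod (t + u) n0))); last first.
  by move=> s; rewrite (modn_small (ltn_ord s)) eq_sym.
rewrite [RHS]mulrACA -cisD /=; congr (_ * _).
have -> : - (2 * pi * t%:R * k%:~R / n%:R) + - (2 * pi * u%:R * k%:~R / n%:R)
  = - (2 * pi * ((t + u) %% n)%:R * k%:~R / n%:R)
    + 2 * pi * (- (((t + u) %/ n)%:Z * k))%:~R :> R.
  have : (t + u)%:R = ((t + u) %/ n)%:R * n%:R + ((t + u) %% n)%:R :> R.
    by rewrite {1}(divn_eq (t + u) n) natrD natrM.
  rewrite natrD => H; rewrite rmorphN rmorphM /= -pmulrn.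
  have -> : u%:R = ((t + u) %/ n)%:R * n%:R + ((t + u) %% n)%:R - t%:R :> R.
    by rewrite -H addrAC subrr add0r.
  by field.
by rewrite cisD cis_period mulr1.
Qed.

(* Main.v *)
Require Import Defs.
From HB Require Import structures.
From mathcomp Require Import all_boot all_order all_algebra.
From mathcomp Require Import complex ring lra zify.
From mathcomp Require Import reals sequences exp trigo.

Set Implicit Arguments.
Unset Strict Implicit.
Unset Printing Implicit Defensive.

Import Order.TTheory GRing.Theory Num.Theory.

Local Open Scope ring_scope.
Local Open Scope complex_scope.

(** Both sides only see the coefficients [dft f k] with [0 < k <= n./2].
    Since [rho] has period [a] in the multiplicative sense,
    [rho (a ^ j * k) = rho k], and [f * psi_j] samples one and the same
    polynomial whatever [j] is: up to a nonzero factor depending on [j] and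
    [s], its entry [s] is the value at [z = exp(- a ^ j) * cis (2 pi s / n)] of
    the polynomial [P] with coefficients [dft f k * rho k * k ^ p]
    ([circ_conv_wavelet]).  Let [Q] be the polynomial of [g].  The two moduli
    conditions say that [|P| = |Q|] at [n] equidistributed points of each of
    two circles centred at the origin, and [f_+ = cis phi *: g_+ + c] says that
    [P = cis phi *: Q], the constant absorbing the frequency zero.

    Let [d = n./2 - 1] bound the degrees of [P] and [Q].  On the circle
    [|z|^2 = t] the conjugate of [P(z)] is, up to a power of the conjugate of
    [z], the value at [z / t] of the conjugate reciprocal [P*]; so
    [P(z) P*(z / t) = Q(z) Q*(z / t)] at [n > 2 d] points, hence identically
    ([eq_norm_conj_recip]).  Taking this for the two radii and eliminating
    [P Q] leaves [P*(z / t) Q*(z / u) = Q*(z / t) P*(z / u)]: the rational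
    function [P* / Q*] is invariant under the dilation of ratio [u / t], which
    is positive and not 1, so it is constant ([dilation_colinear]).  Thus
    [P = c *: Q], and [|c| = 1] because the moduli agree at some point where
    [Q] does not vanish. *)

(** * Polynomials and dilations *)

Lemma exprM_swap_inj (F : numFieldType) (x y : F) (a b : nat) :
  0 < x -> 0 < y -> x != y -> x ^+ a * y ^+ b = x ^+ b * y ^+ a -> a = b.
Proof.
move=> x0 y0 xy; wlog ltab : a b / (a < b)%N => [H e|].
  by have [/H|/H H'|//] := ltngtP a b; [apply|apply/esym/H'/esym].
rewrite -(subnKC (ltnW ltab)) !exprD mulrA [RHS]mulrAC.
have xya : x ^+ a * y ^+ a != 0 by rewrite mulf_neq0 ?expf_neq0 ?gt_eqF.
move/(mulfI xya)/esym/eqP; rewrite eqrXn2 ?(negPf xy) ?ltW //.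
by rewrite subn_gt0.
Qed.

(** The rational function [U / V] is invariant under a dilation of infinite
    order, hence constant.  Comparing leading coefficients, the relation forces
    [U] and [V] to have the same degree when [U] is nonzero; being linear in
    [U], it also holds for [U - c *: V], where [c] is chosen to lower the
    degree, so that difference vanishes. *)
Lemma dilation_colinear (F : numFieldType) (x y : F) (U V : {poly F}) :
  0 < x -> 0 < y -> x != y -> V != 0 ->
  (U \Po (x *: 'X)) * (V \Po (y *: 'X))
    = (V \Po (x *: 'X)) * (U \Po (y *: 'X)) ->
  exists c, U = c *: V.
Proof.
move=> x0 y0 xy V0.
have lcX (W : {poly F}) (z : F) : 0 < z ->
    lead_coef (W \Po (z *: 'X)) = lead_coef W * z ^+ (size W).-1.
  move=> z0; rewrite lead_coef_comp ?lead_coefZ ?lead_coefX ?mulr1 //.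
  by rewrite size_scale ?size_polyX // gt_eqF.
have same_size (W : {poly F}) : W != 0 ->
    (W \Po (x *: 'X)) * (V \Po (y *: 'X))
      = (V \Po (x *: 'X)) * (W \Po (y *: 'X)) -> size W = size V.
  move=> W0 /(congr1 lead_coef); rewrite !lead_coefM !lcX //.
  have WV0 : lead_coef W * lead_coef V != 0 by rewrite mulf_neq0 ?lead_coef_eq0.
  rewrite mulrACA [RHS]mulrACA [lead_coef V * _]mulrC.
  move/(mulfI WV0)/(exprM_swap_inj x0 y0 xy).
  by move: W0 V0; rewrite -!size_poly_gt0; lia.
move=> e; have [->|U0] := eqVneq U 0; first by exists 0; rewrite scale0r.
have sUV := same_size _ U0 e.
pose c := lead_coef U / lead_coef V.
exists c; apply/eqP; rewrite -subr_eq0; apply/negPn/negP => D0.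
have : size (U - c *: V) = size V.
  apply: same_size => //.
  by rewrite !comp_polyB !comp_polyZ !mulrBl !mulrBr e -!scalerAl -!scalerAr.
apply/eqP; rewrite ltn_eqF //.
have Vl : lead_coef V != 0 by rewrite lead_coef_eq0.
have V1 : (0 < size V)%N by rewrite size_poly_gt0.
rewrite -[ltnRHS](prednK V1) ltnS; apply/leq_sizeP => i.
rewrite leq_eqVlt => /predU1P[<-|hi]; rewrite coefB coefZ.
  by rewrite -lead_coefE /c divfK // lead_coefE sUV subrr.
by rewrite !nth_default ?mulr0 ?subr0 ?sUV // -[leqLHS](prednK V1).
Qed.

(** * Moduli on circles *)

(** The polynomial [z ^ d * conj (P (1 / conj z))]; the bound [d] on the degree
    is a parameter, so that the map is a semilinear involution on the
    polynomials of degree at most [d], including those of lower degree. *)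
Definition conj_recip (C : numClosedFieldType) (d : nat) (P : {poly C}) :
    {poly C} :=
  \poly_(i < d.+1) (P`_(d - i))^*%R.

Lemma conj_recipK (C : numClosedFieldType) (d : nat) (P : {poly C}) :
  (size P <= d.+1)%N -> conj_recip d (conj_recip d P) = P.
Proof.
move=> sP; apply/polyP => i; rewrite !coef_poly.
case: (ltnP i d.+1) => [id|di]; last first.
  by rewrite nth_default // (leq_trans sP di).
by rewrite ltnS leq_subr subKn // conjCK.
Qed.

Lemma conj_recipZ (C : numClosedFieldType) (d : nat) (c : C) (P : {poly C}) :
  conj_recip d (c *: P) = c^*%R *: conj_recip d P.
Proof.
apply/polyP => i; rewrite coefZ !coef_poly.
by case: ifP => _; rewrite ?mulr0 // coefZ rmorphM.
Qed.

Lemma horner_conj_recip (C : numClosedFieldType) (d : nat) (P : {poly C})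
    (z : C) :
  (size P <= d.+1)%N -> z != 0 ->
  z^*%R ^+ d * (conj_recip d P).[z^*%R^-1] = P.[z]^*%R.
Proof.
move=> sP z0; have cz0 : z^*%R != 0 by rewrite conjC_eq0.
rewrite horner_poly (horner_coef_wide _ sP) mulr_sumr rmorph_sum /=.
rewrite (reindex_inj rev_ord_inj) /=; apply: eq_bigr => i _.
have id : (i <= d)%N by rewrite -ltnS.
rewrite subSS subKn // rmorphM rmorphXn /= exprVn mulrCA; congr (_ * _).
by rewrite -[in X in X * _](subnK id) exprD mulrAC divff ?mul1r // expf_neq0.
Qed.

(** On the circle [|z|^2 = t], the inverse of the conjugate of [z] is [z / t],
    so [|P(z)|^2] is a power of the conjugate of [z] times the value at [z] of
    a polynomial of degree at most [2 d]; more than [2 d] points determine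
    it. *)
Lemma eq_norm_conj_recip (C : numClosedFieldType) (d : nat) (P Q : {poly C})
    (t : C) (zs : seq C) :
  (size P <= d.+1)%N -> (size Q <= d.+1)%N -> t != 0 ->
  uniq zs -> (d.*2 < size zs)%N ->
  {in zs, forall z, `|z| ^+ 2 = t} ->
  {in zs, forall z, `|P.[z]| = `|Q.[z]|} ->
  P * (conj_recip d P \Po (t^-1 *: 'X)) = Q * (conj_recip d Q \Po (t^-1 *: 'X)).
Proof.
move=> sP sQ t0 Uz szs zt PQ.
have bound (W : {poly C}) (sW : (size W <= d.+1)%N) :
    (size (W * (conj_recip d W \Po (t^-1 *: 'X)))%R <= d.*2.+1)%N.
  apply: leq_trans (size_polyMleq _ _) _.
  rewrite size_comp_poly2 ?size_scale ?invr_neq0 ?size_polyX //.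
  have sr : (size (conj_recip d W) <= d.+1)%N by exact: size_poly.
  by have := leq_add sW sr; set x := addn _ _; lia.
apply/eqP; rewrite -subr_eq0; apply/eqP/(@roots_geq_poly_eq0 _ _ zs) => //.
  apply/allP => z zzs; have z0 : z != 0.
    by move: t0; rewrite -(zt _ zzs) expf_eq0 normr_eq0.
  have cz0 : z^*%R ^+ d != 0 by rewrite expf_neq0 // conjC_eq0.
  have zE : t^-1 * z = z^*%R^-1.
    by rewrite -(zt _ zzs) normCK invfM mulrAC mulVf ?mul1r.
  rewrite /root hornerD hornerN !hornerM !horner_comp !hornerZ !hornerX zE.
  rewrite subr_eq0; apply/eqP/(mulfI cz0).
  by rewrite !(mulrCA (z^*%R ^+ d)) !horner_conj_recip // -!normCK PQ.
apply: leq_trans (size_polyD _ _) _; rewrite size_polyN geq_max.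
by rewrite !(leq_trans (bound _ _) szs).
Qed.

(** A single circle would leave the freedom of reflecting roots in it
    (Blaschke factors); reflections in two concentric circles compose to a
    nontrivial dilation, which no finite set of nonzero roots survives. *)
Lemma two_circles_phase (C : numClosedFieldType) (d : nat) (P Q : {poly C})
    (t u : C) (zs ws : seq C) :
  (size P <= d.+1)%N -> (size Q <= d.+1)%N -> 0 < t -> 0 < u -> t != u ->
  uniq zs -> (d.*2 < size zs)%N -> {in zs, forall z, `|z| ^+ 2 = t} ->
  uniq ws -> (d.*2 < size ws)%N -> {in ws, forall z, `|z| ^+ 2 = u} ->
  {in zs, forall z, `|P.[z]| = `|Q.[z]|} ->
  {in ws, forall z, `|P.[z]| = `|Q.[z]|} ->
  exists2 c, `|c| = 1 & P = c *: Q.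
Proof.
move=> sP sQ t0 u0 tu Uz szs zt Uw sws wu PQz PQw.
have vanish (W : {poly C}) (sW : (size W <= d.+1)%N) :
    {in zs, forall z, W.[z] = 0} -> W = 0.
  move=> W0; apply: (@roots_geq_poly_eq0 _ _ zs) => //; last first.
    by apply: leq_trans sW _; apply: leq_trans szs; lia.
  by apply/allP => z /W0/eqP.
have [Q0|Q0] := eqVneq Q 0.
  exists 1; rewrite ?normr1 // Q0 scaler0; apply: vanish => // z /PQz.
  by rewrite Q0 horner0 normr0 => /eqP; rewrite normr_eq0 => /eqP.
have [P0|P0] := eqVneq P 0.
  case/eqP: Q0; apply: vanish => // z /PQz/esym.
  by rewrite P0 horner0 normr0 => /eqP; rewrite normr_eq0 => /eqP.
have et := eq_norm_conj_recip sP sQ (lt0r_neq0 t0) Uz szs zt PQz.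
have eu := eq_norm_conj_recip sP sQ (lt0r_neq0 u0) Uw sws wu PQw.
have [c Pc] : exists c, conj_recip d P = c *: conj_recip d Q.
  apply: (@dilation_colinear _ t^-1 u^-1); rewrite ?invr_gt0 //.
  - by apply: contra_neq tu => /invr_inj.
  - apply: contra_neq Q0 => Q0; rewrite -(conj_recipK sQ) Q0.
    by rewrite -[0](scale0r (0 : {poly C})) conj_recipZ conjC0 !scale0r.
  (* [et] times the mirror image of [eu], after cancelling [P * Q]. *)
  - apply/(mulfI (mulf_neq0 P0 Q0)).
    by rewrite mulrACA et [P * Q]mulrC -eu mulrACA [X in X * _ = _]mulrC; ring.
have {}Pc : P = c^*%R *: Q.
  by rewrite -(conj_recipK sP) Pc conj_recipZ conj_recipK.
(* If [|c| <> 1], then [|c| * |Q| = |Q|] makes [Q] vanish on [zs]. *)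
exists c^*%R => //; apply/eqP/negPn/negP => c1.
case/eqP: Q0; apply: vanish => // z /PQz; rewrite Pc hornerZ normrM => /eqP.
rewrite -subr_eq0 -{2}[`|Q.[z]|]mul1r -mulrBl mulf_eq0 subr_eq0 (negPf c1) /=.
by rewrite normr_eq0 => /eqP.
Qed.

(** * The unit circle *)

Lemma cis_norm1 (R : realType) (z : R[i]) : `|z| = 1 -> exists x, z = cis x.
Proof.
case: z => x y /eqP; rewrite normc_def /= => /eqP[] h.
have {}h : x ^+ 2 + y ^+ 2 = 1.
  by rewrite -[LHS]sqr_sqrtr ?addr_ge0 ?sqr_ge0 // h expr1n.
have x1 : -1 <= x <= 1 by rewrite !expr2 in h; nra.
have sE : sin (acos x) = `|y|.
  by rewrite sin_acos // -h addrAC subrr add0r sqrtr_sqr.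
have [y0|y0] := ltP y 0.
- exists (- acos x); rewrite /cis cosN sinN acosK ?in_itv //= sE ltr0_norm //.
  by rewrite opprK.
- by exists (acos x); rewrite /cis acosK ?in_itv //= sE ger0_norm.
Qed.

Lemma norm_cis (R : realType) (x : R) : `|cis x| = 1.
Proof. by rewrite normc_def /= cos2Dsin2 sqrtr1. Qed.

(** If the values at [s <> t] agreed, every term of the vanishing geometric sum
    [sum_cis] for the frequency [s - t] would be [1]. *)
Lemma cis_unity_root_inj (R : realType) (n : nat) :
  injective (fun s : 'I_n => cis (2 * pi * s%:R / n%:R : R)).
Proof.
move=> s t /= st; apply/val_inj/eqP/negPn/negP => /= nst.
have n0 : (n%:R : R) != 0 by rewrite pnatr_eq0; have := ltn_ord s; lia.
have n0' : (n%:R : R[i]) != 0 by rewrite pnatr_eq0; have := ltn_ord s; lia.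
have dn : (`|(s%:Z - t%:Z)%R| < n)%N.
  by have := ltn_ord s; have := ltn_ord t; lia.
have := sum_cis R dn; rewrite ifN; last by rewrite subr_eq0 eqz_nat.
rewrite (eq_bigr (fun=> 1)) => [|r _].
  by rewrite sumr_const card_ord => /eqP; rewrite (negPf n0').
have -> : 2 * pi * r%:R * (s%:Z - t%:Z)%:~R / n%:R
    = r%:R * (2 * pi * s%:R / n%:R) + r%:R * - (2 * pi * t%:R / n%:R) :> R.
  by rewrite rmorphB /= -!pmulrn; field.
by rewrite cisD !cisMn st -exprMn mulrC cisNM expr1n.
Qed.

(** * Discrete Fourier transforms *)

(** Constants are the signals whose transform is concentrated at the frequency
    zero. *)
Lemma eq_up_to_constant (R : realType) (n : nat) (u v : 'rV[R[i]]_n)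
    (w : R[i]) :
  (0 < n)%N -> ~~ odd n ->
  (exists c, u = w *: v + const_mx c) <->
  (forall k : int, freq n k -> k != 0 -> dft u k = w * dft v k).
Proof.
move=> n0 en; split=> [[c ->] k fk k0|uv].
  have dk : (`|(- k)%R| < n)%N by move: fk; rewrite /freq; lia.
  have := sum_cis R dk; rewrite ifN ?oppr_eq0 // => sum0.
  rewrite /dft mulr_sumr -[RHS]addr0 -[X in _ = _ + X](mulr0 c).
  rewrite -[X in _ = _ + c * X]sum0 [X in _ = _ + X]mulr_sumr.
  rewrite -big_split; apply: eq_bigr => s _ /=.
  by rewrite !mxE mulrDl -mulrA rmorphN /= mulrN mulNr.
exists (n%:R^-1 * (dft u 0 - w * dft v 0)); apply/rowP => s.
have hn : (n./2.-1 < n)%N by lia.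
(* [q0] is the index of the frequency zero. *)
pose q0 : 'I_n := Ordinal hn.
have fq0 : freq_of q0 = 0 by rewrite /freq_of /=; lia.
rewrite -[u in LHS]dftK -[X in w *: X]dftK !mxE.
rewrite mulrCA -mulrDr; congr (_ * _).
rewrite (bigD1 q0) //= [in RHS](bigD1 q0) //= fq0 mulr0 mul0r cis0 !mulr1.
rewrite [X in _ + X = _](_ : _ = w * \sum_(q < n | q != q0)
    dft v (freq_of q) * cis (2 * pi * s%:R * (freq_of q)%:~R / n%:R)).
  by ring.
rewrite mulr_sumr; apply: eq_bigr => q qq0; rewrite mulrA uv ?freq_ofP //.
by apply: contra_neq qq0 => fq; apply: val_inj; move: fq; rewrite /freq_of /=; lia.
Qed.

(** The factors 1 and 2 in the analytic part depend on the frequency only, so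
    they cancel. *)
Lemma analytic_part_phase (R : realType) (n : nat) (f g : 'rV[R[i]]_n)
    (w : R[i]) :
  (0 < n)%N -> ~~ odd n ->
  (exists c, analytic_part f = w *: analytic_part g + const_mx c) <->
  (forall i, (i < n./2)%N -> dft f i.+1 = w * dft g i.+1).
Proof.
move=> n0 en; rewrite eq_up_to_constant //.
split=> [fg i hi | fg k fk k0].
  have fi : freq n i.+1 by rewrite /freq; lia.
  have := fg _ fi isT; rewrite /analytic_part !idftK //=.
  case: ifP => // _; rewrite mulrCA => /mulfI; apply.
  by rewrite pnatr_eq0.
rewrite /analytic_part !idftK //; case: ltP => k1; first by rewrite mulr0.
case: k => // -[|i] in fk k0 k1 *; first by [].
have hi : (i < n./2)%N by move: fk; rewrite /freq; lia.
by case: ifP => _; rewrite fg // mulrCA.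
Qed.

Lemma positive_freq_inversion (R : realType) (n : nat) (u : 'rV[R[i]]_n)
    (s : 'I_n) :
  ~~ odd n -> (forall k, freq n k -> k <= 0 -> dft u k = 0) ->
  u 0 s = n%:R^-1 * \sum_(i < n./2)
    dft u i.+1 * cis (2 * pi * s%:R / n%:R) ^+ i.+1.
Proof.
move=> en u0; rewrite -[u in LHS]dftK mxE; congr (_ * _).
pose F m := dft u (m%:Z - (n./2)%:Z + 1)
            * cis (2 * pi * s%:R * (m%:Z - (n./2)%:Z + 1)%:~R / n%:R).
rewrite -[LHS](big_mkord predT F) (@big_cat_nat _ _ _ n./2) //=; last by lia.
rewrite big_nat_cond big1 ?add0r => [|m /andP[/andP[_ hm] _]].
  rewrite -[n./2 in X in X = _]add0n big_addn big_mkord.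
  have -> : (n - n./2)%N = n./2 by lia.
  apply: eq_bigr => i _; rewrite /F -cisMn.
  have -> : (i + n./2)%N%:Z - (n./2)%:Z + 1 = i.+1 by lia.
  by congr (_ * cis _); rewrite -pmulrn; ring.
by rewrite /F u0 ?mul0r // /freq; lia.
Qed.

(** * Wavelet transforms as values of a polynomial *)

Lemma log_periodic_expz (R : realType) (T : Type) (a : R) (rho : R -> T) :
  0 < a -> (forall x, 0 < x -> rho (a * x) = rho x) ->
  forall (j : int) x, 0 < x -> rho (a ^ j * x) = rho x.
Proof.
move=> a0 rho_per j x x0.
have per (m : nat) y : 0 < y -> rho (a ^+ m * y) = rho y.
  move=> y0; elim: m => [|m IH]; first by rewrite mul1r.
  by rewrite exprS -mulrA rho_per ?IH // mulr_gt0 ?exprn_gt0.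
case: j => m; first exact: per.
rewrite NegzE -exprnN -(per m.+1) ?mulr_gt0 ?invr_gt0 ?exprn_gt0 //.
by rewrite mulVKf // gt_eqF ?exprn_gt0.
Qed.

(** The index is shifted by one, the frequency zero being killed by the
    wavelets: this keeps the degree below [n./2], so that [n] points exceed
    twice the degree. *)
Definition spectral_poly (R : realType) (n : nat) (p : R) (rho : R -> R[i])
    (f : 'rV[R[i]]_n) : {poly R[i]} :=
  \poly_(i < n./2) (dft f i.+1 * (rho i.+1%:R * (i.+1%:R `^ p)%:C)).

(** The scale [b] is [a ^ j]; it enters through the radius of the sampling
    point [z] and a scalar factor, and not through the polynomial: the
    exponential factor at frequency [k] is the [k]-th power of [expR (- b)]. *)
Lemma circ_conv_wavelet (R : realType) (n : nat) (b p : R) (rho : R -> R[i])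
    (psi f : 'rV[R[i]]_n) (s : 'I_n) :
  ~~ odd n -> 0 < b -> p != 0 ->
  (forall x, 0 < x -> rho (b * x) = rho x) ->
  (forall k : int, freq n k ->
     dft psi k = rho (b * k%:~R) * ((b * k%:~R) `^ p)%:C
                 * (expR (- (b * k%:~R)))%:C * (if 0 <= k then 1 else 0)) ->
  let z := (expR (- b))%:C * cis (2 * pi * s%:R / n%:R) in
  circ_conv f psi 0 s
    = n%:R^-1 * (b `^ p)%:C * z * (spectral_poly p rho f).[z].
Proof.
move=> en b0 p0 rho_b psiE z.
rewrite positive_freq_inversion // => [|k fk k0]; last first.
  rewrite dft_circ_conv psiE //; case: ltgtP k0 => // [_|->] _.
    by rewrite !mulr0.
  by rewrite mulr0 powR0 // mulr0 !mul0r mulr0.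
rewrite horner_poly -[RHS]mulrA -[RHS]mulrA; congr (_ * _); rewrite !mulr_sumr.
apply: eq_bigr => i _; have fi : freq n i.+1.
  by rewrite /freq; have := ltn_ord i; lia.
have i0 : (0 : R) < i.+1%:R by rewrite ltr0n.
rewrite dft_circ_conv psiE //= -pmulrn rho_b // powRM ?ltW //.
rewrite -mulNr expRM_natr rmorphM rmorphXn /= /z exprMn !exprS; ring.
Qed.

Lemma modulus_circ_convP (R : realType) (n : nat) (b p : R) (rho : R -> R[i])
    (psi f g : 'rV[R[i]]_n) :
  ~~ odd n -> 0 < b -> p != 0 ->
  (forall x, 0 < x -> rho (b * x) = rho x) ->
  (forall k : int, freq n k ->
     dft psi k = rho (b * k%:~R) * ((b * k%:~R) `^ p)%:C
                 * (expR (- (b * k%:~R)))%:C * (if 0 <= k then 1 else 0)) ->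
  let z s := (expR (- b))%:C * cis (2 * pi * s%:R / n%:R) in
  modulus (circ_conv f psi) = modulus (circ_conv g psi) <->
  (forall s : 'I_n,
     `|(spectral_poly p rho f).[z s]| = `|(spectral_poly p rho g).[z s]|).
Proof.
move=> en b0 p0 rho_b psiE z.
have modE (h : 'rV[R[i]]_n) s : modulus h 0 s = `|h 0 s| by rewrite mxE.
split=> [fg s|fg]; last first.
  apply/rowP => s; rewrite !modE !(circ_conv_wavelet _ _ en b0 p0 rho_b psiE).
  by rewrite normrM [RHS]normrM fg.
move/rowP/(_ s): fg.
rewrite !modE !(circ_conv_wavelet _ _ en b0 p0 rho_b psiE) normrM [RHS]normrM.
apply: mulfI; rewrite normr_eq0 !mulf_neq0 //.
- by rewrite invr_eq0 pnatr_eq0; have := ltn_ord s; lia.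
- by rewrite fmorph_eq0 gt_eqF ?powR_gt0.
- by rewrite fmorph_eq0 gt_eqF ?expR_gt0.
- by rewrite -normr_eq0 norm_cis oner_eq0.
Qed.

Lemma spectral_poly_phase (R : realType) (n : nat) (p : R) (rho : R -> R[i])
    (f g : 'rV[R[i]]_n) (w : R[i]) :
  (forall x : R, 0 < x -> rho x <> 0) ->
  spectral_poly p rho f = w *: spectral_poly p rho g <->
  (forall i, (i < n./2)%N -> dft f i.+1 = w * dft g i.+1).
Proof.
move=> rho0; split=> [/polyP fg i hi|fg]; last first.
  apply/polyP => i; rewrite coefZ !coef_poly; case: ifP => hi.
    by rewrite fg // [RHS]mulrA.
  by rewrite mulr0.
have := fg i; rewrite coefZ !coef_poly hi [X in _ = X -> _]mulrA; apply: mulIf.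
rewrite mulf_neq0 //; first by apply/eqP/rho0; rewrite ltr0n.
by rewrite fmorph_eq0 gt_eqF // powR_gt0 // ltr0n.
Qed.

(** * Phase retrieval from two scales *)

Theorem theorem2p6 (R : realType) (n : nat) (a p : R) (rho : R -> R[i])
    (n_gt0 : (0 < n)%N) (n_even : ~~ odd n) (a_gt1 : 1 < a) (p_gt0 : 0 < p)
    (rho_neq0 : forall x : R, 0 < x -> rho x <> 0)
    (rho_per : forall x : R, 0 < x -> rho (a * x) = rho x)
    (psi : int -> 'rV[R[i]]_n)
    (psiE : forall (j k : int), freq n k ->
       dft (psi j) k =
         rho (a ^ j * k%:~R)
         * ((a ^ j * k%:~R) `^ p)%:C
         * (expR (- (a ^ j * k%:~R)))%:C
         * (if 0 <= k then 1 else 0))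
    (f g : 'rV[R[i]]_n) (j l : int) (neq_jl : j <> l) :
  (modulus (circ_conv f (psi j)) = modulus (circ_conv g (psi j)) /\
   modulus (circ_conv f (psi l)) = modulus (circ_conv g (psi l)))
  <->
  (exists (phi : R) (c : R[i]),
     analytic_part f = cis phi *: analytic_part g + const_mx c).
Proof.
have a0 : 0 < a := lt_trans ltr01 a_gt1.
have modP i := modulus_circ_convP f g n_even (exprz_gt0 i a0)
  (lt0r_neq0 p_gt0) (log_periodic_expz a0 rho_per i) (psiE i).
pose circle i := [seq (expR (- a ^ i))%:C * cis (2 * pi * s%:R / n%:R : R)
                 | s : 'I_n].
have r0 i : 0 < (expR (- a ^ i))%:C by rewrite ltcR expR_gt0.
have circle_uniq i : uniq (circle i).
  rewrite map_inj_uniq ?enum_uniq // => s t.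
  by move/(mulfI (lt0r_neq0 (r0 i)))/cis_unity_root_inj.
have circle_norm i :
    {in circle i, forall z, `|z| ^+ 2 = (expR (- a ^ i))%:C ^+ 2}.
  by move=> _ /imageP[s _ ->]; rewrite normrM norm_cis mulr1 gtr0_norm.
have circle_size i : (n./2.-1.*2 < size (circle i))%N.
  by rewrite size_image card_ord; lia.
have spec_size (h : 'rV[R[i]]_n) :
    (size (spectral_poly p rho h) <= n./2.-1.+1)%N.
  by rewrite (leq_trans (size_poly _ _)) //; lia.
split=> [[/modP fgj /modP fgl]|[phi /analytic_part_phase-/(_ n_gt0 n_even) fg]].
  have jl : (expR (- a ^ j))%:C ^+ 2 != (expR (- a ^ l))%:C ^+ 2.
    rewrite eqrXn2 ?ltW // (inj_eq (@complexI _)) (inj_eq (@expR_inj _)).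
    rewrite eqr_opp; by apply/eqP => /(ieexprIz a0 (negbT (gt_eqF a_gt1))).
  have [c c1 fgc] : exists2 c, `|c| = 1 &
      spectral_poly p rho f = c *: spectral_poly p rho g.
    apply: (two_circles_phase (spec_size f) (spec_size g) _ _ jl
      (circle_uniq j) (circle_size j) (circle_norm j)
      (circle_uniq l) (circle_size l) (circle_norm l)).
    - by rewrite exprn_gt0.
    - by rewrite exprn_gt0.
    - by move=> _ /imageP[s _ ->].
    - by move=> _ /imageP[s _ ->].
  have [phi cE] := cis_norm1 c1; exists phi; apply/analytic_part_phase => //.
  by rewrite -cE; apply/(spectral_poly_phase p f g c rho_neq0).
suff spec : spectral_poly p rho f = cis phi *: spectral_poly p rho g.
  by split; apply/modP => s; rewrite spec hornerZ normrM norm_cis mul1r.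
exact/spectral_poly_phase.
Qed.
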